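(* Let $(T,d)$ be a rooted compact real tree. There exists a continuous function $c\in\mathcal{H}$ such that $(T_c,d_c)$ and $(T,d)$ are isometric. (Notation defined in the context.)
   Context: A metric space $(T,d)$ is a real tree if: (1) for all $\sigma,\sigma'\in T$ there is an isometry (distance-preserving map) $f_{\sigma,\sigma'}:[0,d(\sigma,\sigma')]\to T$ with $f_{\sigma,\sigma'}(0)=\sigma$ and $f_{\sigma,\sigma'}(d(\sigma,\sigma'))=\sigma'$; write $[\![\sigma,\sigma']\!]$ for its image; (2) if $q:[0,1]\to T$ is continuous and injective then $q([0,1])=[\![q(0),q(1)]\!]$. Rooted means that a point $\rho\in T$ is distinguished. For $M\geq 0$, $\mathcal{H}_M$ is the set of non-negative functions $h$ on $[0,M]$ that are left-continuous with right-limits and satisfy $h(0)=h(0+)=0$ and $h(t)-h(t+)\geq 0$ for $t\in[0,M)$ (conditions on right-limits are void if $M=0$); $\mathcal{H}=\bigcup_{M\ge 0}\mathcal{H}_M$. For $h\in\mathcal{H}_M$ and $s,t\in[0,M]$ set $d_h(s,t)=h(s)+h(t)-2\inf_{r\in[s\wedge t,s\vee t]}h(r)$ (a pseudo-distance). Let $s\sim_h t$ iff $d_h(s,t)=0$, and $T_h=[0,M]/\sim_h$ with the induced distance, still denoted $d_h$. *)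

(* Defs.v *)
From HB Require Import structures.
From mathcomp Require Import all_boot all_order all_algebra generic_quotient.
From mathcomp Require Import all_classical all_reals all_analysis.
From mathcomp Require Import lra.

Set Implicit Arguments.
Unset Strict Implicit.
Unset Printing Implicit Defensive.

Import Order.TTheory GRing.Theory Num.Theory.
Import numFieldNormedType.Exports.

Local Open Scope classical_set_scope.
Local Open Scope ring_scope.

Section metric_notions.
Context {R : realType}.

Definition isometric (X Y : metricType R) : Prop :=
  exists2 f : X -> Y,
    forall x y, mdist (f x) (f y) = mdist x y & bijective f.

(* [g] is only constrained on [0, mdist s t]. *)
Definition geodesic (T : metricType R) (s t : T) (g : R -> T) : Prop :=
  [/\ {in `[0, mdist s t] &, forall x y, mdist (g x) (g y) = `|x - y|},
      g 0 = s & g (mdist s t) = t].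

(* [f s t] is the chosen isometry from s to t; its image is the segment
   [[s, t]], which by the second clause does not depend on the choice. *)
Definition real_tree (T : metricType R) : Prop :=
  exists f : T -> T -> R -> T,
    (forall s t, geodesic s t (f s t)) /\
    (forall q : R -> T,
       {within `[0, 1], continuous q} -> {in `[0, 1] &, injective q} ->
       q @` `[0, 1] = f (q 0) (q 1) @` `[0, mdist (q 0) (q 1)]).

End metric_notions.

Section coding.
Context {R : realType}.

(* Functions on [0, M] are represented by total functions R -> R whose values
   outside [0, M] are irrelevant. *)
Definition coding (M : R) : set (R -> R) := [set h : R -> R |
  [/\ 0 <= M,
      (forall t : R, 0 <= t <= M -> 0 <= h t),
      (forall t : R, 0 < t <= M -> h x @[x --> t^'-] --> h t),
      h 0 = 0 /\ (0 < M -> h x @[x --> 0^'+] --> (0 : R)) &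
      forall t : R, 0 <= t < M ->
        exists l : R, h x @[x --> t^'+] --> l /\ 0 <= h t - l]].

(* The union of the sets [coding M]; the length M of the domain is part of the data. *)
Record codingFun := CodingFun {
  len : R ;
  hfun :> R -> R ;
  hfunP : coding len hfun }.

Definition code_dist (h : R -> R) (s t : R) : R :=
  h s + h t - 2 * inf [set h r | r in `[Num.min s t, Num.max s t]].

Lemma code_distC (h : R -> R) s t : code_dist h s t = code_dist h t s.
Proof. by rewrite /code_dist minC maxC (addrC (h s)). Qed.

Lemma code_distxx (h : R -> R) s : code_dist h s s = 0.
Proof.
rewrite /code_dist minxx maxxx (_ : [set _ | _ in _] = [set h s]) ?inf1; first by lra.
by rewrite set_itv1 image_set1.
Qed.

Definition code_dom (h : codingFun) : Type := {t : R | t \in `[0, len h]}.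
HB.instance Definition _ (h : codingFun) := Choice.on (code_dom h).

Section quotient.
Variable h : codingFun.
Implicit Types s t u : code_dom h.

Let hI s t : set R :=
  [set h r | r in `[Num.min (val s) (val t), Num.max (val s) (val t)]].

Let subdom s t r :
  Num.min (val s) (val t) <= r <= Num.max (val s) (val t) -> 0 <= r <= len h.
Proof.
have := valP s; have := valP t; rewrite !in_itv/= => /andP[t0 tM] /andP[s0 sM].
move=> /andP[sr rt]; rewrite (le_trans _ sr) ?le_min ?s0 ?t0//=.
by rewrite (le_trans rt)// ge_max sM tM.
Qed.

Let hI_lb s t : lbound (hI s t) 0.
Proof.
move=> x [r /=]; rewrite in_itv/= => /subdom rM <-.
by case: (hfunP h) => _ + _ _ _; apply.
Qed.

Let hI_inf s t : has_inf (hI s t).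
Proof.
split; last by exists 0; exact: hI_lb.
exists (h (val s)), (val s) => //=.
by rewrite in_itv/= ge_min le_max !lexx.
Qed.

Let hI_le s t r : Num.min (val s) (val t) <= r <= Num.max (val s) (val t) ->
  inf (hI s t) <= h r.
Proof. by move=> rst; apply: ge_inf; [case: (hI_inf s t)|exists r]. Qed.

Lemma code_dist_ge0 s t : 0 <= code_dist h (val s) (val t).
Proof.
have : inf (hI s t) <= h (val s) by apply: hI_le; rewrite ge_min le_max !lexx.
have : inf (hI s t) <= h (val t).
  by apply: hI_le; rewrite ge_min le_max !lexx !orbT.
by rewrite /code_dist -/(hI s t); lra.
Qed.

Lemma code_dist_triangle t s u :
  code_dist h (val s) (val u) <= code_dist h (val s) (val t) + code_dist h (val t) (val u).
Proof.
have st : inf (hI s t) <= h (val t).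
  by apply: hI_le; rewrite ge_min le_max !lexx !orbT.
have tu : inf (hI t u) <= h (val t) by apply: hI_le; rewrite ge_min le_max !lexx.
suff : Num.min (inf (hI s t)) (inf (hI t u)) <= inf (hI s u).
  by rewrite /code_dist -/(hI s t) -/(hI t u) -/(hI s u) ge_min => /orP[]; lra.
apply: lb_le_inf; first by case: (hI_inf s u).
move=> x [r /= + <-]; rewrite in_itv/= => rsu.
have [rst|rst] :=
  boolP (Num.min (val s) (val t) <= r <= Num.max (val s) (val t)).
  by rewrite ge_min hI_le.
rewrite ge_min (@hI_le t u) ?orbT//; move: rsu rst.
rewrite !ge_min !le_max.
have := le_total r (val t).
case: (leP (val s) r); case: (leP r (val s)); case: (leP (val t) r);
  case: (leP r (val t)); case: (leP (val u) r); case: (leP r (val u)) => //=.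
all: lra.
Qed.

Definition sim s t : bool := code_dist h (val s) (val t) == 0.

Lemma sim_equiv : equiv_class_of sim.
Proof.
split=> [s|s t|t s u]; rewrite /sim; first by rewrite code_distxx.
  by rewrite code_distC.
move=> /eqP st /eqP tu; rewrite eq_le code_dist_ge0 andbT.
by rewrite (le_trans (code_dist_triangle t s u))// st tu addr0.
Qed.

Canonical sim_equiv_rel := EquivRelPack sim_equiv.

Definition code_tree : Type := {eq_quot sim}%qT.
HB.instance Definition _ := Choice.on code_tree.

Definition tree_pi (s : code_dom h) : code_tree := (\pi_({eq_quot sim}) s)%qT.
Definition tree_dist (x y : code_tree) : R := code_dist h (val (repr x)) (val (repr y)).

Let code_dist_repr s : code_dist h (val (repr (tree_pi s))) (val s) = 0.
Proof. by apply/eqP; have /eqmodP := reprK (tree_pi s). Qed.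

Lemma tree_dist_pi s t : tree_dist (tree_pi s) (tree_pi t) = code_dist h (val s) (val t).
Proof.
rewrite /tree_dist; set s' := repr (tree_pi s); set t' := repr (tree_pi t).
have ss := code_dist_repr s; have tt := code_dist_repr t; rewrite -/s' in ss; rewrite -/t' in tt.
have := code_dist_triangle s s' t'; have := code_dist_triangle t s t'.
have := code_dist_triangle s' s t; have := code_dist_triangle t' s' t.
rewrite (code_distC h (val s) (val s')) (code_distC h (val t) (val t')) ss tt.
lra.
Qed.

Let tree_distxx x : tree_dist x x = 0. Proof. exact: code_distxx. Qed.

Let tree_dist_eq0 x y : tree_dist x y = 0 -> x = y.
Proof.
move=> /eqP xy; rewrite -[x]reprK -[y]reprK; exact/eqmodP.
Qed.

Let tree_distC x y : tree_dist x y = tree_dist y x. Proof. exact: code_distC. Qed.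

Let tree_dist_triangle y x z : tree_dist x z <= tree_dist x y + tree_dist y z.
Proof. exact: code_dist_triangle. Qed.

HB.instance Definition _ :=
  isMetric.Build R code_tree tree_distxx tree_dist_eq0 tree_distC tree_dist_triangle.

Lemma tree_mdistE s t : mdist (tree_pi s) (tree_pi t) = code_dist h (val s) (val t).
Proof. exact: tree_dist_pi. Qed.

End quotient.
End coding.

(* Main.v *)
Require Import Defs.
From mathcomp Require Import all_boot all_order all_algebra.
From mathcomp Require Import generic_quotient.
From mathcomp Require Import all_classical all_reals all_analysis.
From mathcomp Require Import ring lra.
Import Order.TTheory GRing.Theory Num.Theory.
Import numFieldNormedType.Exports.
Set Implicit Arguments.
Unset Strict Implicit.
Unset Printing Implicit Defensive.
Local Open Scope classical_set_scope.
Local Open Scope ring_scope.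

(** A compact real tree is coded by a continuous walk that explores it in
depth-first order, started at the root; the code is the distance c(t) of the
walker p(t) to the root.  All that is needed of p is that it is continuous, is
onto, starts at the root, and is a contour: on each time interval [s, t], the
minimum m of c satisfies d(p s, p t) = c s + c t - 2 m.  Indeed the right-hand
side is then the pseudo-distance defined by c, so that p induces an isometry
from the coded tree onto T ([limit_isometric]).

The walk is a uniform limit of explorations, i.e. Lipschitz contours whose
ranges are geodesically convex compact subtrees containing the root.  An
exploration p is enlarged to reach a new point x by an insertion: let y be the
point of the range of p closest to x, visited at time t0; stop the clock of p
at t0 for a duration eta, during which the walker goes from y to x and back
along the segment [y, x].  Since T has no cycle, every geodesic from the range
of p to a point of that segment goes through y ([expl_gate]), which is why the
new walk is again a contour with a convex range ([insert_exploration]).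

Inserting many branches one after the other must not move the walk too much.
Adding up the displacements of the insertions would not do: with k branches of
length e one would get k * e.  Instead, the new walk p' is compared with its
projection on the range of p: the projection of p' t is p s for a time s which
differs from t by at most the total duration H of the insertions
([refines_trans]).  If the range of p is an e-net of T and p is K-Lipschitz, p
and p' are then at uniform distance at most e + K * H ([refines_dist]).  By
compactness, the n-th stage only inserts finitely many branches to make the
range a 2^-n-net, and the durations can be chosen as small as wanted given the
Lipschitz constant reached so far.  The walks thus form a uniform Cauchy
sequence, all of them exhausting their ranges during the time interval [0, 1]
([exploration_approx]).  The contour property is closed under uniform limits
([limit_contour]), and the limit maps [0, 1] to a compact set, dense by the
choice of the nets, hence onto T ([limit_onto]). *)

(** * Betweenness in real trees *)

Lemma ler_distE {R : realType} (s t : R) : s <= t -> `|s - t| = t - s.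
Proof. by move=> st; rewrite ler0_norm ?opprB// subr_le0. Qed.

Section segments.
Context {R : realType} {T : metricType R}.
Implicit Types (s t : R) (a b m u w x y z : T) (A : set T).

Definition between a m b := mdist a m + mdist m b = mdist a b.

Definition geod_convex A := forall a m b, A a -> A b -> between a m b -> A m.

Lemma between_sym a m b : between a m b -> between b m a.
Proof.
by rewrite /between (metric_sym b m) (metric_sym m a) (metric_sym b a) addrC.
Qed.

Lemma between_xx a m : between a m a -> m = a.
Proof.
rewrite /between mdistxx (metric_sym m a) => h; apply/esym/mdist_positivity.
lra.
Qed.

Lemma between_r a b : between a b b.
Proof. by rewrite /between mdistxx addr0. Qed.

Lemma between_trans_r a y z x : between a y x -> between y z x -> between a y z.
Proof.
rewrite /between => h1 h2.
have := metric_triangle a y z; have := metric_triangle a z x; lra.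
Qed.

Lemma between_trans_l a m b u : between a m b -> between a u m -> between a u b.
Proof.
rewrite /between => h1 h2.
have := metric_triangle a u b; have := metric_triangle u m b; lra.
Qed.

Lemma lipschitz_within_continuous (q : R -> T) (K : R) (A : set R) :
  (forall s t, A s -> A t -> mdist (q s) (q t) <= K * `|s - t|) ->
  {within A, continuous q}.
Proof.
move=> qK; apply/subspace_continuousP => s As.
apply/metricType_numDomainType.cvgrPdist_lt => e e0; rewrite near_withinE.
have K0 : 0 < `|K| + 1 by rewrite ltr_wpDl.
near=> t => At; apply: le_lt_trans (qK _ _ As At) _.
have st : `|s - t| < e / (`|K| + 1).
  by near: t; apply: cvgr_dist_lt; [exact: cvg_id|rewrite divr_gt0].
rewrite (@le_lt_trans _ _ ((`|K| + 1) * `|s - t|))//.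
  by rewrite ler_wpM2r// (le_trans (ler_norm K))// lerDl.
by rewrite mulrC -ltr_pdivlMr.
Unshelve. all: by end_near. Qed.

Lemma geodesic_between a b (g : R -> T) t :
  geodesic a b g -> 0 <= t <= mdist a b ->
  [/\ between a (g t) b, mdist a (g t) = t & mdist (g t) b = mdist a b - t].
Proof.
move=> [gi g0 gl] tab.
have e1 : mdist a (g t) = t.
  by rewrite -{1}g0 gi ?in_itv//= ?sub0r ?normrN ?ger0_norm; lra.
have e2 : mdist (g t) b = mdist a b - t.
  by rewrite -{1}gl gi ?in_itv//=; [rewrite ler_distE; lra|lra].
by split=> //; rewrite /between e1 e2; lra.
Qed.

(** Two geodesics that only meet at their common endpoint m make up an
injective path, so by the second axiom of real trees m lies on the segment from
a to b.  Every later use of the absence of cycles goes through this lemma. *)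
Lemma geodesic_concat (f : T -> T -> R -> T) a m b :
  (forall x y, geodesic x y (f x y)) ->
  (forall q : R -> T,
     {within `[0, 1], continuous q} -> {in `[0, 1] &, injective q} ->
     q @` `[0, 1] = f (q 0) (q 1) @` `[0, mdist (q 0) (q 1)]) ->
  (forall u, between a u m -> between m u b -> u = m) ->
  exists2 t, 0 <= t <= mdist a b & f a b t = m.
Proof.
move=> fgeo farc am_mb.
have [am|am] := eqVneq a m.
  by exists 0; [rewrite lexx mdist_ge0|rewrite -am; case: (fgeo a b)].
have [mb|mb] := eqVneq m b.
  by exists (mdist a b); [rewrite lexx mdist_ge0|rewrite mb; case: (fgeo a b)].
have [g1i g10 g1l] := fgeo a m; have [g2i g20 g2l] := fgeo m b.
move: am mb; rewrite -!mdist_gt0.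
set l1 := mdist a m in g1i g1l *; set l2 := mdist m b in g2i g2l *.
set g1 := f a m in g1i g10 g1l; set g2 := f m b in g2i g20 g2l.
move=> l1_gt0 l2_gt0.
pose Q t := if t <= l1 then g1 t else g2 (t - l1).
have g1E (s t : R) : 0 <= s <= l1 -> 0 <= t <= l1 ->
    mdist (g1 s) (g1 t) = `|s - t|.
  by move=> s1 t1; apply: g1i; rewrite in_itv.
have g2E (s t : R) : 0 <= s <= l2 -> 0 <= t <= l2 ->
    mdist (g2 s) (g2 t) = `|s - t|.
  by move=> s1 t1; apply: g2i; rewrite in_itv.
have g1m (s : R) : 0 <= s <= l1 -> mdist (g1 s) m = l1 - s.
  move=> s1; rewrite -g1l g1E//; last by lra.
  by rewrite ler_distE; lra.
have g2m (s : R) : 0 <= s <= l2 -> mdist m (g2 s) = s.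
  move=> s1; rewrite -g20 g2E//; last by lra.
  by rewrite ler_distE; lra.
have g1a (s : R) : 0 <= s <= l1 -> between a (g1 s) m.
  move=> s1; rewrite /between g1m// -g10 g1E//; last by lra.
  by rewrite ler_distE; [rewrite -/l1 g10 -/l1; lra|lra].
have g2b (s : R) : 0 <= s <= l2 -> between m (g2 s) b.
  move=> s1; rewrite /between g2m// -g2l g2E//; last by lra.
  by rewrite ler_distE; [rewrite g2l -/l2; lra|lra].
(* The bound gives continuity; positivity gives injectivity, because the two
   halves only meet at m. *)
have QE (s t : R) : 0 <= s -> t <= l1 + l2 -> s < t ->
    mdist (Q s) (Q t) <= t - s /\ 0 < mdist (Q s) (Q t).
  move=> s0 tl st; rewrite /Q.
  case: (leP s l1) => sl1; case: (leP t l1) => tl1; try by lra.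
  - have e1 : mdist (g1 s) (g1 t) = t - s by rewrite g1E ?ler_distE; lra.
    by rewrite e1 lexx subr_gt0.
  - split.
      apply: (le_trans (metric_triangle _ m _)); rewrite g1m ?g2m; lra.
    rewrite mdist_gt0; apply/eqP => e.
    have s1 : 0 <= s <= l1 by lra.
    have t1 : 0 <= t - l1 <= l2 by lra.
    have em : g1 s = m by apply: am_mb; [exact: g1a|rewrite e; exact: g2b].
    by move: tl1; rewrite -subr_gt0 -(g2m _ t1) -e em mdistxx ltxx.
  - have e1 : mdist (g2 (s - l1)) (g2 (t - l1)) = t - s.
      by rewrite g2E ?ler_distE; lra.
    by rewrite e1 lexx subr_gt0.
pose L := l1 + l2; have L0 : 0 < L by rewrite /L; lra.
pose q t := Q (t * L).
have qE (s t : R) : 0 <= s -> t <= 1 -> s < t ->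
    mdist (q s) (q t) <= L * (t - s) /\ 0 < mdist (q s) (q t).
  move=> s0 t1 st; rewrite mulrBr ![L * _]mulrC; apply: QE.
  - by rewrite mulr_ge0// ltW.
  - by rewrite -[leRHS]mul1r ler_wpM2r// ltW.
  - by rewrite ltr_pM2r.
have qcont : {within `[0, 1], continuous q}.
  apply: (@lipschitz_within_continuous _ L) => s t /=.
  rewrite !in_itv/= => s01 t01.
  case: (ltgtP s t) => [st|ts|->]; last by rewrite mdistxx subrr normr0 mulr0.
    by rewrite ltr0_norm ?subr_lt0// opprB; apply: (qE _ _ _ _ st).1; lra.
  by rewrite metric_sym gtr0_norm ?subr_gt0//; apply: (qE _ _ _ _ ts).1; lra.
have qinj : {in `[0, 1] &, injective q}.
  move=> s t; rewrite !in_itv/= => s01 t01 e.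
  case: (ltgtP s t) => // [st|ts].
    suff : q s != q t by rewrite e eqxx.
    by rewrite -mdist_gt0; apply: (qE _ _ _ _ st).2; lra.
  suff : q t != q s by rewrite e eqxx.
  by rewrite -mdist_gt0; apply: (qE _ _ _ _ ts).2; lra.
have := farc q qcont qinj.
have -> : q 0 = a by rewrite /q mul0r /Q ltW.
have -> : q 1 = b.
  rewrite /q mul1r /Q ifF; last by rewrite /L; lra.
  by rewrite /L addrAC subrr add0r.
move=> /seteqP[+ _] => /(_ m)[].
  exists (l1 / L) => /=; last by rewrite /q divfK ?gt_eqF// /Q lexx.
  rewrite in_itv/= divr_ge0 ?ltW//= ltr_pdivrMr// mul1r /L; lra.
by move=> t /=; rewrite in_itv; exists t.
Qed.

Hypothesis Ttree : real_tree T.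

(** This turns the absence of cycles into a statement on distances alone; no
path needs to be built from now on. *)
Lemma between_of_disjoint a m b :
  (forall u, between a u m -> between m u b -> u = m) -> between a m b.
Proof.
have [f [fgeo farc]] := Ttree.
move=> /(geodesic_concat fgeo farc)[t tab <-].
by case: (geodesic_between (fgeo a b) tab).
Qed.

(** Points metrically between a and b are on the segment: the two halves of
any metric decomposition of a geodesic only meet at the cutting point. *)
Lemma tree_geodesic a b : exists2 g : R -> T, geodesic a b g &
  forall m, between a m b -> g (mdist a m) = m.
Proof.
have [f [fgeo farc]] := Ttree.
exists (f a b) => // m amb.
have [|t tab <-] := @geodesic_concat f a m b fgeo farc.
  move=> u; rewrite /between => h1 h2.
  apply: mdist_positivity; have := metric_triangle a u b.
  have := mdist_ge0 u m; rewrite (metric_sym u m) /between in amb h1 *; lra.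
by case: (geodesic_between (fgeo a b) tab) => _ ->.
Qed.

(** A metric segment of a tree is linearly ordered by the distance to an
endpoint, since it is isometric to a real interval. *)
Lemma between_between a m m' b :
  between a m b -> between a m' b -> mdist a m <= mdist a m' ->
  between a m m' /\ between m m' b.
Proof.
have [g [gi _ _] gb] := tree_geodesic a b.
move=> amb am'b mm'.
have l x : between a x b -> mdist a x \in `[0, mdist a b].
  by rewrite in_itv/= mdist_ge0 /between => <-; rewrite lerDl mdist_ge0.
have e : mdist m m' = mdist a m' - mdist a m.
  by rewrite -{1}(gb m)// -{1}(gb m')// gi ?l// ler_distE.
by move: amb am'b; rewrite /between e => h1 h2; lra.
Qed.

(** A geodesic from A to the branch must enter the branch at y, so it is cut
by y into a part in A and a part in the branch. *)
Lemma geod_convex_graft A x y :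
  geod_convex A -> A y -> (forall a, A a -> between a y x) ->
  geod_convex (A `|` [set z | between y z x]).
Proof.
move=> Ac Ay Ayx.
have mix a m b : A a -> between y b x -> between a m b ->
    (A `|` [set z | between y z x]) m.
  move=> Aa yb amb; have ayb := between_trans_r (Ayx _ Aa) yb.
  have [amy|yma] := lerP (mdist a m) (mdist a y).
    by left; apply: (Ac a m y) => //; case: (between_between amb ayb amy).
  right; have [_ ymb] := between_between ayb amb (ltW yma).
  exact: between_trans_l yb ymb.
move=> a m b [Aa|ya] [Ab|yb] amb.
- by left; exact: Ac amb.
- exact: mix amb.
- by apply: mix Ab ya _; exact: between_sym.
- right; move: a b ya yb amb; rewrite /=.
  have wl a b : between y a x -> between y b x -> mdist y a <= mdist y b ->
      between a m b -> between y m x.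
    move=> ya yb ab amb; have [yab _] := between_between ya yb ab.
    apply: between_trans_l yb _.
    exact/between_sym/(between_trans_l (between_sym yab))/between_sym.
  move=> a b ya yb amb; have [ab|ba] := lerP (mdist y a) (mdist y b).
    exact: wl ab amb.
  by apply: (wl b a) => //; [exact: ltW|exact: between_sym].
Qed.
End segments.

(** * The clock of an insertion *)

Section pause.
Context {R : realType}.
Variables (t0 eta : R).
Hypothesis eta0 : 0 < eta.
Implicit Types s t u : R.

Definition pausing t := t0 <= t <= t0 + eta.

(** The clock of the old walk while an excursion is inserted at time t0. *)
Definition pause t :=
  if t <= t0 then t else if t <= t0 + eta then t0 else t - eta.

(** Distance to the starting point of the excursion, walked at unit speed. *)
Definition tent t :=
  if t <= t0 then 0 else if t <= t0 + eta / 2 then t - t0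
  else if t <= t0 + eta then t0 + eta - t else 0.

Ltac pause_cases :=
  repeat match goal with
  | |- context [if ?x <= ?y then _ else _] =>
    case: (leP x y) => ?; try (exfalso; lra)
  end.

Lemma pause_in t : pausing t -> pause t = t0.
Proof.
by have e0 := eta0; rewrite /pausing /pause => tin; pause_cases; lra.
Qed.

Lemma pause_mono s t : s <= t -> pause s <= pause t.
Proof. by have e0 := eta0; rewrite /pause; pause_cases; lra. Qed.

Lemma pause_close t : t - eta <= pause t <= t.
Proof. by have e0 := eta0; rewrite /pause; pause_cases; lra. Qed.

Lemma pause_lip s t : s <= t -> pause t - pause s <= t - s.
Proof. by have e0 := eta0; rewrite /pause; pause_cases; lra. Qed.

Lemma tent_ge0 t : 0 <= tent t.
Proof. by have e0 := eta0; rewrite /tent; pause_cases; lra. Qed.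

Lemma tent_le t : tent t <= eta / 2.
Proof. by have e0 := eta0; rewrite /tent; pause_cases; lra. Qed.

Lemma tent_lip s t : `|tent s - tent t| <= `|s - t|.
Proof.
wlog st : s t / s <= t.
  move=> h; case: (leP s t) => [/h//|/ltW/h].
  by rewrite (distrC s) (distrC (tent s)).
have e0 := eta0; rewrite (ler_distE st) ler_norml /tent; pause_cases; lra.
Qed.

Lemma tent_out t : ~~ pausing t -> tent t = 0.
Proof. by have e0 := eta0; rewrite /pausing /tent => tin; pause_cases; lra. Qed.

Lemma tent_quasi_concave s u t :
  t0 <= s -> t <= t0 + eta -> s <= u <= t ->
  tent s <= tent u \/ tent t <= tent u.
Proof.
have e0 := eta0; move=> s0 t1 sut.
case: (leP u (t0 + eta / 2)) => ?; [left|right];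
  rewrite /tent; pause_cases; lra.
Qed.

(** With u a minimizer of the old height over [pause s, pause t], this shows
that the new height goes as low over [s, t].  The hypothesis excludes the
intervals contained in the pause, during which the walker may be strictly inside
the excursion all the time. *)
Lemma pause_lift s t u : s <= t -> ~~ (pausing s && pausing t) ->
  pause s <= u <= pause t ->
  exists v, [/\ s <= v <= t, pause v = u & tent v = 0].
Proof.
have e0 := eta0; rewrite /pausing => st nst sut.
case/andP: sut => su ut.
have [u0|u0|u0] := ltgtP u t0.
- have su' : s <= u by move: su; rewrite /pause; pause_cases; lra.
  have ut' : u <= t by have := pause_close t; lra.
  exists u; split; [lra| |]; first by rewrite /pause; pause_cases; lra.
  by rewrite /tent; pause_cases; lra.
- have ut' : u + eta <= t by move: ut; rewrite /pause; pause_cases; lra.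
  have su' : s <= u + eta by have := pause_close s; lra.
  exists (u + eta); split; [lra| |]; first by rewrite /pause; pause_cases; lra.
  by rewrite /tent; pause_cases; lra.
- have [s0|s0] := leP s t0.
    have t0t : t0 <= t by have := pause_close t; lra.
    exists t0; split; [lra| |]; first by rewrite /pause; pause_cases; lra.
    by rewrite /tent; pause_cases; lra.
  have s1 : s <= t0 + eta by move: su; rewrite /pause; pause_cases; lra.
  have t1 : t0 + eta < t.
    rewrite ltNge; apply/negP => t1; move/negP: nst; apply.
    by apply/andP; split; lra.
  exists (t0 + eta); split; [lra| |]; first by rewrite /pause; pause_cases; lra.
  by rewrite /tent; pause_cases; lra.
Qed.

End pause.

(** * Explorations and the insertion of a branch *)

Section exploration.
Context {R : realType} {T : metricType R}.
Implicit Types (s t u : R) (a b m w x y z : T) (p : R -> T).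
Variable rho : T.

Definition contour p := forall s t, s <= t -> exists r,
  [/\ s <= r <= t,
      forall u, s <= u <= t -> mdist rho (p r) <= mdist rho (p u) &
      mdist (p s) (p t) =
        mdist rho (p s) + mdist rho (p t) - 2 * mdist rho (p r)].

(** Walks are indexed by the whole line, and [expl_range] says that only the
times in [0, M] matter; this avoids tracking the time interval in all other
clauses.  The Lipschitz constant K is kept because it bounds how short the next
excursions must be for the walk to be hardly delayed. *)
Record exploration p (M K : R) : Prop := Exploration {
  expl_start : p 0 = rho ;
  expl_M0 : 0 <= M ;
  expl_K0 : 0 <= K ;
  expl_lip : forall s t, mdist (p s) (p t) <= K * `|s - t| ;
  expl_range : forall t, exists2 t', 0 <= t' <= M & p t' = p t ;
  expl_convex : geod_convex (range p) ;
  expl_contour : contour p }.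

(** p' is an enlargement of p delayed by at most H: p s is the projection of
p' t on the range of p, expressed by the fact that every geodesic from the
range of p to p' t goes through it. *)
Definition refines p p' H := forall t, exists2 s,
  `|s - t| <= H & forall r, between (p r) (p s) (p' t).

Lemma refines_refl p : refines p p 0.
Proof.
by move=> t; exists t => [|r]; [rewrite subrr normr0|exact: between_r].
Qed.

(** Delays add up, whereas distances do not appear: the projection on the
range of p is the projection on the larger range of p' followed by the one on
the range of p. *)
Lemma refines_trans p p' p'' H H' : range p `<=` range p' ->
  refines p p' H -> refines p' p'' H' -> refines p p'' (H + H').
Proof.
move=> pp' r1 r2 t; have [s' s't bs'] := r2 t; have [s ss' bs] := r1 s'.
exists s => [|r].
  have -> : s - t = (s - s') + (s' - t) by rewrite addrA subrK.
  by rewrite (le_trans (ler_normD _ _))// lerD.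
have [r' _ pr'] := pp' _ (imageP p (I : setT r)).
have h := bs r; rewrite -pr' in h *.
exact: between_trans_l (bs' r') h.
Qed.

Lemma dist_uniform_continuous p x :
  (forall e : R, 0 < e -> exists2 d : R, 0 < d &
     forall s t, `|s - t| < d -> mdist (p s) (p t) < e) ->
  continuous (fun t => mdist x (p t)).
Proof.
move=> pu t; apply/cvgrPdist_lt => e /pu[d d0 dp].
near=> s; have h : mdist (p t) (p s) < e.
  by apply: dp; near: s; apply: cvgr_dist_lt; [exact: cvg_id|].
have := metric_triangle x (p t) (p s); have := metric_triangle x (p s) (p t).
rewrite (metric_sym (p s)) ltr_norml => *; lra.
Unshelve. all: by end_near. Qed.

Lemma expl_unif p M K : exploration p M K -> forall e : R, 0 < e ->
  exists2 d : R, 0 < d & forall s t, `|s - t| < d -> mdist (p s) (p t) < e.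
Proof.
move=> pE e e0; have K0 := expl_K0 pE; exists (e / (K + 1)).
  by rewrite divr_gt0//; lra.
move=> s t; rewrite ltr_pdivlMr; last by lra.
apply: le_lt_trans; apply: (le_trans (expl_lip pE _ _)).
by rewrite mulrC ler_wpM2l//; lra.
Qed.

Hypothesis Ttree : real_tree T.

(** Take for t0 a time minimizing the distance to x: by convexity, a geodesic
inside the range of p ending at p t0 only meets the segment from p t0 to x at
p t0, so that the two concatenate. *)
Lemma expl_gate p M K x : exploration p M K ->
  exists2 t0, 0 <= t0 <= M & forall s, between (p s) (p t0) x.
Proof.
move=> pE; have pc := @dist_uniform_continuous p x (expl_unif pE).
have [|t0 + t0min] :=
    @EVT_min R (fun t => mdist x (p t)) 0 M (expl_M0 pE).
  exact: continuous_subspaceT pc.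
rewrite in_itv => t0M; exists t0 => // s.
apply: (between_of_disjoint Ttree) => u su ux.
have [r _ pr] := expl_convex pE (imageP p (I : setT s))
  (imageP p (I : setT t0)) su.
have [r' r'M pr'] := expl_range pE r.
have := t0min r'; rewrite in_itv => /(_ r'M); rewrite pr' pr => h.
apply/esym/mdist_positivity; move: ux h; rewrite /between.
have := mdist_ge0 (p t0) u; rewrite (metric_sym x u) (metric_sym x (p t0)); lra.
Qed.

Section insertion.
Variables (p : R -> T) (M K : R) (t0 eta : R) (x : T) (g : R -> T).
Let y := p t0.
Let l := mdist y x.
Hypothesis pE : exploration p M K.
Hypothesis eta0 : 0 < eta.
Hypothesis t0M : 0 <= t0 <= M.
Hypothesis gate : forall s, between (p s) y x.
Hypothesis ggeo : geodesic y x g.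
Hypothesis gb : forall m, between y m x -> g (mdist y m) = m.

Let L := 2 * l / eta.

(** The factor L turns the tent, of height eta / 2, into an excursion of
height l, the length of the branch. *)
Definition insert t : T :=
  if pausing t0 eta t then g (L * tent t0 eta t) else p (pause t0 eta t).

Let l0 : 0 <= l. Proof. exact: mdist_ge0. Qed.
Let L0 : 0 <= L. Proof. by rewrite /L !mulr_ge0// invr_ge0 ltW. Qed.
Let Leta : L * (eta / 2) = l.
Proof. by rewrite /L; field; rewrite gt_eqF. Qed.

Let Ltent t : 0 <= L * tent t0 eta t <= l.
Proof.
by rewrite mulr_ge0 ?tent_ge0//= -Leta ler_wpM2l// tent_le.
Qed.

Let insert_gate t r : between (p r) (p (pause t0 eta t)) (insert t).
Proof.
rewrite /insert; case: ifPn => [tin|_]; last exact: between_r.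
rewrite (pause_in eta0 tin).
apply: (between_trans_r (gate r)).
by case: (geodesic_between ggeo (Ltent t)).
Qed.

Let insert_dist t : mdist (p (pause t0 eta t)) (insert t) = L * tent t0 eta t.
Proof.
rewrite /insert; case: ifPn => [tin|tout].
  rewrite (pause_in eta0 tin).
  by case: (geodesic_between ggeo (Ltent t)).
by rewrite mdistxx (tent_out eta0 tout) mulr0.
Qed.

(** Seen from the range of p, the inserted branch is reached through y. *)
Let insert_from r t :
  mdist (p r) (insert t) = mdist (p r) (p (pause t0 eta t)) + L * tent t0 eta t.
Proof. by rewrite -(insert_gate t r) insert_dist. Qed.

Let insert_height t : mdist rho (insert t) =
  mdist rho (p (pause t0 eta t)) + L * tent t0 eta t.
Proof. by rewrite -{1 2}(expl_start pE) insert_from. Qed.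

(** The vanishing of the product makes the sum of the two tents the absolute
value of their difference, which the Lipschitz bound needs. *)
Let insert_out s t : ~~ (pausing t0 eta s && pausing t0 eta t) ->
  mdist (insert s) (insert t) =
  mdist (p (pause t0 eta s)) (p (pause t0 eta t)) +
    L * tent t0 eta s + L * tent t0 eta t /\
  tent t0 eta s * tent t0 eta t = 0.
Proof.
rewrite negb_and => /orP[so|to_].
  rewrite {1}/insert (negbTE so) insert_from (tent_out eta0 so) mul0r mulr0.
  by rewrite addr0.
rewrite metric_sym {1}/insert (negbTE to_) insert_from (tent_out eta0 to_).
by rewrite !mulr0 addr0 metric_sym.
Qed.

Let insert_in s t : pausing t0 eta s -> pausing t0 eta t ->
  mdist (insert s) (insert t) = `|L * tent t0 eta s - L * tent t0 eta t|.
Proof.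
move=> si ti; rewrite /insert si ti; case: ggeo => gi _ _.
by rewrite gi// in_itv; exact: Ltent.
Qed.

Let insert_lip s t : mdist (insert s) (insert t) <= (K + L) * `|s - t|.
Proof.
wlog st : s t / s <= t.
  move=> h; case: (leP s t) => [/h//|/ltW/h].
  by rewrite (metric_sym (insert s)) (distrC s).
have tl : L * `|tent t0 eta s - tent t0 eta t| <= L * `|s - t|.
  by rewrite ler_wpM2l// tent_lip.
have Ks : 0 <= K * `|s - t| by rewrite mulr_ge0// (expl_K0 pE).
have [/andP[si ti]|/insert_out[-> tt0]] :=
  boolP (pausing t0 eta s && pausing t0 eta t).
  rewrite (insert_in si ti) -mulrBr normrM (ger0_norm L0); lra.
rewrite -addrA; have -> : L * tent t0 eta s + L * tent t0 eta t =
    L * `|tent t0 eta s - tent t0 eta t| :> R.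
  have s0 := tent_ge0 t0 eta0 s; have u0 := tent_ge0 t0 eta0 t.
  move/eqP : tt0; rewrite mulf_eq0 => /orP[]/eqP ->.
    by rewrite mulr0 add0r sub0r normrN ger0_norm.
  by rewrite mulr0 addr0 subr0 ger0_norm.
have := expl_lip pE (pause t0 eta s) (pause t0 eta t).
have ps := pause_mono t0 eta0 st; have pl := pause_lip t0 eta0 st.
rewrite (ler_distE ps) (ler_distE st) in tl * => h.
have : K * (pause t0 eta t - pause t0 eta s) <= K * (t - s).
  by rewrite ler_wpM2l// (expl_K0 pE).
lra.
Qed.

(** Unless [s, t] is contained in the pause, the minimum of the height of p is
lifted to the new time scale.  Within the pause, heights first increase and then
decrease, so that the minimum is attained at an endpoint of [s, t]. *)
Let insert_contour : contour insert.
Proof.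
move=> s t st.
have [/andP[si ti]|nst] := boolP (pausing t0 eta s && pausing t0 eta t).
  have qc u : s <= u <= t -> tent t0 eta s <= tent t0 eta u \/
                             tent t0 eta t <= tent t0 eta u.
    move: si ti => /andP[si _] /andP[_ ti]; exact: tent_quasi_concave.
  have ui u : s <= u <= t -> pausing t0 eta u.
    by move: si ti; rewrite /pausing; lra.
  have hE u : s <= u <= t ->
      mdist rho (insert u) = mdist rho y + L * tent t0 eta u.
    by move=> /ui uin; rewrite insert_height (pause_in eta0 uin).
  have [sst tst] : s <= s <= t /\ s <= t <= t by lra.
  rewrite (insert_in si ti).
  have Lle u v : tent t0 eta u <= tent t0 eta v ->
      L * tent t0 eta u <= L * tent t0 eta v by exact: ler_wpM2l.
  have [le|/ltW le] := leP (tent t0 eta s) (tent t0 eta t).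
    exists s; split=> //; last first.
      rewrite !hE// -normrN opprB ger0_norm; first by lra.
      by rewrite subr_ge0 Lle.
    move=> u sut; rewrite !hE// lerD2l Lle//.
    by case: (qc _ sut) => // /(le_trans le).
  exists t; split=> //; last first.
    rewrite !hE// ger0_norm; first by lra.
    by rewrite subr_ge0 Lle.
  move=> u sut; rewrite !hE// lerD2l Lle//.
  by case: (qc _ sut) => // /(le_trans le).
have [r [sr rmin pd]] := expl_contour pE (pause_mono t0 eta0 st).
have [v [sv pv tv]] := pause_lift eta0 st nst sr.
exists v; split=> //.
  move=> u /andP[su ut]; rewrite !insert_height pv tv mulr0 addr0.
  rewrite (le_trans (rmin (pause t0 eta u) _)) ?pause_mono//.
  by case/andP: (Ltent u); rewrite lerDl.
have [-> _] := insert_out nst.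
rewrite !insert_height pv tv mulr0 addr0 pd; lra.
Qed.

Let insert_eq t : tent t0 eta t = 0 -> insert t = p (pause t0 eta t).
Proof.
move=> tt0; apply/esym/mdist_positivity.
by rewrite insert_dist tt0 mulr0.
Qed.

Let insert_lift r : exists2 t, r <= t <= r + eta & insert t = p r.
Proof.
have e0 := eta0; have [rt|rt] := leP r t0.
  exists r; first by lra.
  by rewrite insert_eq ?/pause /tent rt.
have rt1 : (r + eta <= t0) = false by lra.
have rt2 : (r + eta <= t0 + eta) = false by lra.
have rt3 : (r + eta <= t0 + eta / 2) = false by lra.
exists (r + eta); first by lra.
by rewrite insert_eq ?/pause /tent rt1 rt2 ?rt3// addrK.
Qed.

Let sub_insert : range p `<=` range insert.
Proof. by move=> _ [r _ <-]; have [t _ <-] := insert_lift r; exists t. Qed.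

Let insert_branch_range : range insert = range p `|` [set z | between y z x].
Proof.
apply/seteqP; split=> [_ [t _ <-]|z [|/= yz]]; last first.
- have yz_l : mdist y z <= l.
    by move: yz; rewrite /between -/l => <-; rewrite lerDl mdist_ge0.
  have [l_0|l_neq0] := eqVneq l 0.
    apply: sub_insert; exists t0 => //; apply: mdist_positivity; apply/eqP.
    by rewrite -/y eq_le mdist_ge0 andbT (le_trans yz_l) ?l_0.
  have lgt : 0 < l by rewrite lt_def l_neq0.
  have Lgt : 0 < L by rewrite /L divr_gt0 ?mulr_gt0.
  have e0 := eta0.
  have q0 : 0 <= mdist y z / L by rewrite divr_ge0 ?mdist_ge0.
  have q1 : mdist y z / L <= eta / 2 by rewrite ler_pdivrMr// mulrC Leta.
  exists (t0 + mdist y z / L) => //.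
  rewrite /insert ifT; last by rewrite /pausing; lra.
  have -> : tent t0 eta (t0 + mdist y z / L) = mdist y z / L.
    rewrite /tent lerD2l q1; case: leP => h; lra.
  by rewrite mulrC divfK ?gt_eqF// gb.
- exact: sub_insert.
- rewrite /insert; case: ifP => _; last by left.
  by right; case: (geodesic_between ggeo (Ltent t)).
Qed.

Lemma insert_exploration : exploration insert (M + eta) (K + L).
Proof.
have e0 := eta0; have t0M' := t0M.
split=> //.
- rewrite insert_eq /pause /tent ifT ?(expl_start pE)//; lra.
- by rewrite addr_ge0 ?(expl_M0 pE)// ltW.
- by rewrite addr_ge0 ?(expl_K0 pE).
- move=> t; have [tin|tout] := boolP (pausing t0 eta t).
    by exists t => //; move: tin; rewrite /pausing; lra.
  rewrite (insert_eq (tent_out eta0 tout)).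
  have [r rM <-] := expl_range pE (pause t0 eta t).
  by have [t' t'r <-] := insert_lift r; exists t' => //; lra.
- rewrite insert_branch_range.
  have py : range p y by exists t0.
  apply: (geod_convex_graft Ttree (expl_convex pE) py).
  by move=> _ [s _ <-].
Qed.

Lemma insert_refines : refines p insert eta.
Proof.
move=> t; exists (pause t0 eta t) => [|r]; last exact: insert_gate.
have e0 := eta0; have := pause_close t0 eta0 t; rewrite ler_norml; lra.
Qed.

Lemma insert_reaches : range insert x.
Proof. by rewrite insert_branch_range; right; exact: between_r. Qed.

Lemma insert_extends : range p `<=` range insert.
Proof. exact: sub_insert. Qed.

End insertion.

(** The branch is inserted where the walk visits the projection of x on its
range; its duration eta is arbitrary. *)
Lemma exploration_insert p M K x (eta : R) : exploration p M K -> 0 < eta ->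
  exists p' K', [/\ exploration p' (M + eta) K', refines p p' eta,
    range p `<=` range p' & range p' x].
Proof.
move=> pE eta0; have [t0 t0M gate] := expl_gate x pE.
have [g ggeo gb] := tree_geodesic Ttree (p t0) x.
exists (insert p t0 eta x g); eexists; split.
- exact: (insert_exploration pE eta0 t0M gate ggeo gb).
- exact: (insert_refines eta0 gate ggeo).
- exact: (insert_extends eta0 ggeo).
- exact: (insert_reaches eta0 ggeo gb).
Qed.

End exploration.

(** * Finite nets and limits in compact spaces *)

Section compact_metric.
Context {R : realType} {T : metricType R}.
Hypothesis Tcompact : compact [set: T].

Definition net (e : R) (A : set T) :=
  forall x, exists2 a, A a & mdist a x <= e.

(** Compactness is applied to the filter of the finite sequences that contain
a given one. *)
Lemma finite_net (e : R) : 0 < e -> exists s : seq T, net e [set` s].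
Proof.
move=> e0.
pose F : set_system (seq T) :=
  filter_from setT (fun s0 : seq T => [set s : seq T | {subset s0 <= s}]).
have FF : Filter F.
  apply: filter_from_filter; first by exists [::].
  move=> s1 s2 _ _; exists (s1 ++ s2) => // s /= s12.
  by split=> x xs; apply: s12; rewrite mem_cat xs ?orbT.
move/compact_near_coveringP : Tcompact.
move=> /(_ _ F (fun s x => exists2 a, [set` s] a & mdist a x <= e) FF)[].
  move=> x _; exists (ball x e, [set s : seq T | {subset [:: x] <= s}]) => /=.
    by split; [exact: nbhsx_ballx|exists [:: x]].
  move=> [y s] /= [xy xs]; exists x; first by apply: xs; rewrite mem_head.
  by move: xy; rewrite ballEmdist => /ltW.
by move=> s _ /(_ s)/= h; exists s => x; exact: h.
Qed.

(** A cluster point of the sequence is close to all its terms, since each term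
is close to all the next ones. *)
Lemma geometric_limit (u : nat -> T) :
  (forall n, mdist (u n) (u n.+1) <= 2 * 2^-1 ^+ n) ->
  exists l, forall n, mdist (u n) l <= 4 * 2^-1 ^+ n.
Proof.
move=> ud.
have far n k : mdist (u n) (u (n + k)%N) <= 4 * 2^-1 ^+ n - 4 * 2^-1 ^+ (n + k).
  elim: k => [|k IH]; first by rewrite addn0 mdistxx subrr.
  have := metric_triangle (u n) (u (n + k)%N) (u (n + k).+1).
  rewrite addnS exprS; have := ud (n + k)%N; lra.
have [l [_ lu]] := @Tcompact (u @ \oo) _ (filterS (fun _ _ => I) filterT).
exists l => n; apply/ler_addgt0Pr => e e0.
have [|y []] := lu [set y | mdist (u n) y <= 4 * 2^-1 ^+ n] (ball l e) _
  (nbhsx_ballx l e e0).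
  exists n => // m /= nm; rewrite -(subnKC nm) (le_trans (far _ _))//.
  by rewrite gerBl mulr_ge0// exprn_ge0.
rewrite ballEmdist /= => h1 h2.
have := metric_triangle (u n) y l; rewrite (metric_sym y l); lra.
Qed.

End compact_metric.

(** * Refining explorations to a uniform Cauchy sequence *)

Section approximation.
Context {R : realType} {T : metricType R}.
Implicit Types (s t u : R) (x y z : T) (p : R -> T).
Variable rho : T.
Hypothesis Ttree : real_tree T.
Hypothesis Tcompact : compact [set: T].

Lemma refines_weaken p p' (H H' : R) : H <= H' -> refines p p' H ->
  refines p p' H'.
Proof.
by move=> HH' r t; have [s st b] := r t; exists s => //; exact: le_trans HH'.
Qed.

(** The projection p s of p' t on the range of p is no farther from p' t than
the e-close point provided by the net, and p s is K * H-close to p t. *)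
Lemma refines_dist p M K p' (e H : R) : exploration rho p M K ->
  refines p p' H -> net e (range p) ->
  forall t, mdist (p t) (p' t) <= e + K * H.
Proof.
move=> pE r pn t; have [s st b] := r t; have [_ [q _ <-] qe] := pn (p' t).
have := b q; rewrite /between => bq.
have := expl_lip pE t s; have := metric_triangle (p t) (p s) (p' t).
have := mdist_ge0 (p q) (p s).
have : K * `|t - s| <= K * H by rewrite ler_wpM2l ?(expl_K0 pE)// distrC.
lra.
Qed.

(** The duration H is shared by halving it at each insertion. *)
Lemma exploration_insert_seq (l : seq T) p M K (H : R) :
  exploration rho p M K -> 0 < H ->
  exists p' M' K', [/\ exploration rho p' M' K', M' <= M + H,
    refines p p' H, range p `<=` range p' & [set` l] `<=` range p'].
Proof.
elim: l p M K H => [|x l IH] p M K H pE H0.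
  exists p, M, K; split=> //; first by rewrite lerDl ltW.
  exact: refines_weaken (ltW H0) (refines_refl p).
have H2 : 0 < H / 2 by lra.
have [p1 [K1 [p1E r1 s1 p1x]]] := exploration_insert Ttree x pE H2.
have [p2 [M2 [K2 [p2E M2le r2 s2 l2]]]] := IH _ _ _ _ p1E H2.
exists p2, M2, K2; split=> //.
- lra.
- by rewrite [H]splitr; exact: refines_trans s1 r1 r2.
- exact: subset_trans s1 s2.
- move=> y /=; rewrite inE => /orP[/eqP->|yl]; first exact: s2.
  exact: l2.
Qed.

Lemma exploration_const : exploration rho (fun=> rho) 0 0.
Proof.
split=> //.
- by move=> s t; rewrite mdistxx mul0r.
- by move=> t; exists 0; rewrite ?lexx.
- move=> a m b [s _ <-] [t _ <-] /between_xx ->.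
  by exists 0.
- move=> s t st; exists s; rewrite lexx st.
  by split=> //; rewrite mdistxx; lra.
Qed.

(** The n-th stage lasts at most 2^-(n+1), so that the total duration is at
most 1, and this is further divided by K + 1 so that the delay moves the walk by
at most 2^-(n+1).  The sequence starts after the first stage, as the root alone
need not be a 1-net. *)
Lemma exploration_approx : exists q : nat -> R -> T,
  forall n, [/\ exists M K, exploration rho (q n) M K /\ M <= 1,
    net (2^-1 ^+ n) (range (q n)) &
    forall t, mdist (q n t) (q n.+1 t) <= 2 * 2^-1 ^+ n].
Proof.
pose St := {S : (R -> T) * R * R | exploration rho S.1.1 S.1.2 S.2}.
have pos n : 0 < (2^-1 : R) ^+ n by rewrite exprn_gt0.
have stepP (nS : nat * St) : exists S' : St,
    [/\ (sval S').1.2 <= (sval nS.2).1.2 + 2^-1 ^+ nS.1.+1,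
      net (2^-1 ^+ nS.1) (range (sval S').1.1) &
      refines (sval nS.2).1.1 (sval S').1.1
        (2^-1 ^+ nS.1.+1 / ((sval nS.2).2 + 1))].
  case: nS => n [[[p M] K] /= pE].
  have K0 := expl_K0 pE.
  have K1 : 0 < K + 1 by lra.
  have [l lnet] := finite_net Tcompact (pos n).
  have [p' [M' [K' [p'E M'M r _ lr]]]] :=
    exploration_insert_seq l pE (divr_gt0 (pos n.+1) K1).
  exists (exist _ (p', M', K') p'E); split=> //=.
    apply: (le_trans M'M); rewrite lerD2l ler_pdivrMr//.
    by rewrite ler_peMr ?(ltW (pos _))//; lra.
  by move=> x; have [a /lr la ax] := lnet x; exists a.
have [step stepE] := choice stepP.
pose S := fix S n : St := match n with
  | 0 => exist _ (fun=> rho, 0, 0) exploration_const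
  | n'.+1 => step (n', S n') end.
exists (fun n => (sval (S n.+1)).1.1) => n; split.
- exists (sval (S n.+1)).1.2, (sval (S n.+1)).2.
  split; first exact: (svalP (S n.+1)).
  suff : (sval (S n.+1)).1.2 <= 1 - 2^-1 ^+ n.+1 by have := pos n.+1; lra.
  elim: (n.+1) => [|m IH]; first by rewrite expr0 subrr.
  have [h _ _] := stepE (m, S m); apply: (le_trans h).
  rewrite /= exprS; lra.
- by have [_ h _] := stepE (n, S n).
- have [_ h _] := stepE (n, S n); have [_ _ r] := stepE (n.+1, S n.+1).
  have SE := svalP (S n.+1).
  move=> t; apply: (le_trans (refines_dist SE r h t)).
  rewrite -[leRHS]/((1 + 1) * _) mulrDl mul1r lerD2l /=.
  have K0 := expl_K0 SE; set K := (sval _).2 in K0 *.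
  have p2 := pos n.+2; have -> : (2^-1 : R) ^+ n = 4 * 2^-1 ^+ n.+2.
    by rewrite !exprS; lra.
  rewrite mulrCA -[leRHS]mulrC; apply: ler_wpM2l; first exact: ltW.
  rewrite ler_pdivrMr; lra.
Qed.

Lemma exploration_limit : exists p : R -> T, forall e : R, 0 < e ->
  exists q M K, [/\ exploration rho q M K, M <= 1,
    forall t, mdist (q t) (p t) <= e & net e (range q)].
Proof.
have [q qP] := exploration_approx.
have lim t : exists l, forall n, mdist (q n t) l <= 4 * 2^-1 ^+ n.
  by apply: geometric_limit => // n; case: (qP n).
have [p pP] := choice lim.
exists p => e e0.
have [n ne] : exists n, 4 * (2^-1 : R) ^+ n <= e.
  have half1 : `|2^-1 : R| < 1 by rewrite ger0_norm; lra.
  have e4 : 0 < e / 4 by lra.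
  have /cvgrPdist_le/(_ _ e4)[n _ /(_ n (leqnn n))] := cvg_expr half1.
  rewrite sub0r normrN ger0_norm ?exprn_ge0// => h; exists n; lra.
have [[M [K [qE M1]]] qn _] := qP n.
exists (q n), M, K; split=> //.
  by move=> t; exact: le_trans ne.
move=> x; have [a ? ax] := qn x; exists a => //.
have : 0 < (2^-1 : R) ^+ n by rewrite exprn_gt0.
lra.
Qed.

End approximation.

(** * The limit walk codes the tree *)

Section limit.
Context {R : realType} {T : metricType R}.
Implicit Types (s t u : R) (x y z : T).
Variables (rho : T) (p : R -> T).
Hypothesis p_approx : forall e : R, 0 < e ->
  exists q M K, [/\ exploration rho q M K, M <= 1,
    forall t, mdist (q t) (p t) <= e & net e (range q)].

Let dist_diff x y z : `|mdist x y - mdist x z| <= mdist y z.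
Proof.
have := metric_triangle x y z; have := metric_triangle x z y.
rewrite (metric_sym z y) ler_norml; lra.
Qed.

Lemma limit_start : p 0 = rho.
Proof.
apply/esym/mdist_positivity/eqP; rewrite eq_le mdist_ge0 andbT.
apply/ler_addgt0Pr => e /p_approx[q [M [K [qE _ qp _]]]].
by rewrite add0r -(expl_start qE).
Qed.

Lemma limit_unif (e : R) : 0 < e ->
  exists2 d : R, 0 < d & forall s t, `|s - t| < d -> mdist (p s) (p t) < e.
Proof.
move=> e0; have e3 : 0 < e / 3 by lra.
have [q [M [K [qE _ qp _]]]] := p_approx e3.
have [d d0 qd] := expl_unif qE e3; exists d => // s t /qd h.
have := qp s; have := qp t; rewrite (metric_sym (q s)).
have := metric_triangle (p s) (q s) (p t).
have := metric_triangle (q s) (q t) (p t); lra.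
Qed.

Lemma limit_dist_continuous x : continuous (fun t => mdist x (p t)).
Proof. exact: dist_uniform_continuous limit_unif. Qed.

Let EVT x s t : s <= t -> exists2 r, s <= r <= t &
  forall u, s <= u <= t -> mdist x (p r) <= mdist x (p u).
Proof.
move=> st; have [|r + rmin] := @EVT_min R (fun t => mdist x (p t)) s t st.
  exact/continuous_subspaceT/limit_dist_continuous.
rewrite in_itv => sr; exists r => // u su; exact: rmin.
Qed.

(** The minimum r of c on [s, t] exists by continuity, and it is compared with
the minimum r' of an e/6-close exploration: heights move by e/6 and the distance
of p s and p t by e/3. *)
Lemma limit_contour : contour rho p.
Proof.
move=> s t st; have [r sr rmin] := EVT rho st; exists r; split=> //.
apply/eqP; rewrite eq_le; apply/andP; split; apply/ler_addgt0Pr => e e0.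
all: have e6 : 0 < e / 6 by lra.
all: have [q [M [K [qE _ qp _]]]] := p_approx e6.
all: have [r' [sr' rmin' qd]] := expl_contour qE st.
all: have := rmin _ sr'; have := rmin' _ sr.
all: have hd u : `|mdist rho (q u) - mdist rho (p u)| <= e / 6
       by rewrite (le_trans (dist_diff _ _ _)).
all: have hq : `|mdist (q s) (q t) - mdist (p s) (p t)| <= e / 3.
all: try (have := dist_diff (q s) (q t) (p t);
  have := dist_diff (p t) (q s) (p s);
  rewrite !(metric_sym (p t)) !ler_norml;
  have := qp s; have := qp t; lra).
all: have := hd s; have := hd t; have := hd r; have := hd r'; move: hq.
all: rewrite !ler_norml => *; lra.
Qed.

(** Since every exploration uses only times in [0, 1], the points p t with t in
[0, 1] are dense, and one of them minimizes the distance to x. *)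
Lemma limit_onto x : exists2 t, 0 <= t <= 1 & p t = x.
Proof.
have [t t01 tmin] := EVT x (@ler01 R); exists t => //.
apply/esym/mdist_positivity/eqP; rewrite eq_le mdist_ge0 andbT.
apply/ler_addgt0Pr => e e0; rewrite add0r.
have e2 : 0 < e / 2 by lra.
have [q [M [K [qE M1 qp qn]]]] := p_approx e2.
have [_ [s _ <-] sx] := qn x; have [u uM us] := expl_range qE s.
have := tmin u; rewrite -us in sx; have := qp u.
have := metric_triangle x (q u) (p u); rewrite (metric_sym x (q u)) => h1 h2.
have u01 : 0 <= u <= 1 by lra.
move=> /(_ u01); lra.
Qed.

Let c t := mdist rho (p t).

Lemma limit_coding : coding 1 c.
Proof.
have cc : continuous c by exact: limit_dist_continuous.
have c0 : c 0 = 0 by rewrite /c limit_start mdistxx.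
split=> //.
- by move=> t _; exact: mdist_ge0.
- by move=> t _; apply: cvg_at_left_filter; exact: cc.
- split=> // _; have : c x @[x --> 0^'+] --> c 0.
    by apply: cvg_at_right_filter; exact: cc.
  by rewrite c0.
- move=> t _; exists (c t); split; last by rewrite subrr.
  by apply: cvg_at_right_filter; exact: cc.
Qed.

Lemma contour_code_dist s t : code_dist c s t = mdist (p s) (p t).
Proof.
wlog st : s t / s <= t.
  move=> h; case: (leP s t) => [/h//|/ltW/h].
  by rewrite code_distC metric_sym.
have [r [sr rmin ->]] := limit_contour st.
rewrite /code_dist (min_idPl st) (max_idPr st); congr (_ - 2 * _).
apply/eqP; rewrite eq_le; apply/andP; split.
  apply: ge_inf; last by exists r => //; rewrite /= in_itv.
  by exists 0 => _ [u _ <-]; exact: mdist_ge0.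
apply: lb_le_inf; first by exists (c r), r => //; rewrite /= in_itv.
by move=> _ [u + <-]; rewrite /= in_itv => /rmin.
Qed.

Lemma limit_isometric : isometric (code_tree (CodingFun limit_coding)) T.
Proof.
set h := CodingFun limit_coding.
pose F (a : code_tree h) := p (val (repr a : code_dom h)).
have Fd a b : mdist (F a) (F b) = mdist a b by rewrite -contour_code_dist.
exists F => //.
have Fpi (s : code_dom h) : F (tree_pi s) = p (val s).
  apply: mdist_positivity; rewrite -contour_code_dist.
  rewrite -(@tree_mdistE R h (repr (tree_pi s)) s).
  by rewrite /tree_pi reprK mdistxx.
have Fsurj x : exists a, F a = x.
  have [t t01 <-] := limit_onto x.
  have tin : t \in `[0, len h] by rewrite in_itv.
  by exists (tree_pi (exist _ t tin : code_dom h)); rewrite Fpi.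
have [G GK] := choice Fsurj.
exists G => // a; apply: mdist_positivity.
by rewrite -Fd GK mdistxx.
Qed.

End limit.

Theorem corollary1p2 (R : realType) (T : metricType R) (rho : T)
    (Tcompact : compact [set: T]) (Ttree : real_tree T) :
  exists c : codingFun (R := R),
    {within `[0, len c], continuous (hfun c)} /\ isometric (code_tree c) T.
Proof.
have [p pP] := exploration_limit rho Ttree Tcompact.
exists (CodingFun (limit_coding pP)); split; last exact: limit_isometric.
exact/continuous_subspaceT/(limit_dist_continuous pP).
Qed.
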